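(* Let $P\bowtie G$ be a Zappa-Szép product of a right LCM semigroup $P$ and a group $G$, let $\mathcal{A}$ be a unital C*-algebra, let $X$ be a compactly aligned product system over $P$ with coefficient $\mathcal{A}$, and let $(X,G,\beta)$ be a Zappa-Szép system. Then $\mathcal{NT}_{X\bowtie G}\cong\mathcal{NT}_X\bowtie G$ ($*$-isomorphism of C*-algebras).
   Context: Semigroups and groups are discrete, and every semigroup has an identity, written $e$ (the identity of $G$ is also written $e$). Zappa-Szép product. One is given a left action $G\times P\to P$, $(g,p)\mapsto g\cdot p$, and a map $P\times G\to G$, $(p,g)\mapsto g|_p$, such that for all $g,h\in G$, $p,q\in P$: $e\cdot p=p$; $(gh)\cdot p=g\cdot(h\cdot p)$; $g\cdot e=e$; $g|_e=g$; $g\cdot(pq)=(g\cdot p)(g|_p\cdot q)$; $g|_{pq}=(g|_p)|_q$; $e|_p=e$; $(gh)|_p=g|_{h\cdot p}\,h|_p$. Then $P\bowtie G=P\times G$ with product $(p,g)(q,h)=(p(g\cdot q),\,g|_q h)$ is a semigroup with identity $(e,e)$. A left cancellative semigroup $P$ is right LCM if for all $p,q\in P$ either $pP\cap qP=\emptyset$ or $pP\cap qP=rP$ for some $r\in P$; if $P$ is right LCM then so is $P\bowtie G$ (known). Product system. An $\mathcal{A}$-correspondence is a right Hilbert $\mathcal{A}$-module with a left action of $\mathcal{A}$ by adjointable operators. A product system over a semigroup $P$ with coefficient $\mathcal{A}$ is $X=\bigsqcup_{p\in P}X_p$, with each $X_p$ an $\mathcal{A}$-correspondence, with an associative multiplication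 $X_p\times X_q\to X_{pq}$ such that (1) $X_e=\mathcal{A}$ as an $\mathcal{A}$-correspondence; (2) for all $p,q\in P$ the multiplication extends to a unitary $M_{p,q}:X_p\otimes X_q\to X_{pq}$ (interior tensor product over $\mathcal{A}$); (3) the left and right actions of $\mathcal{A}$ on $X_p$ coincide with the multiplications $X_e\times X_p\to X_p$ and $X_p\times X_e\to X_p$. Compact alignment. $\mathcal{L}(X_p)$ is the C*-algebra of adjointable operators, $\theta_{x,y}(z)=x\langle y,z\rangle$, and $\mathcal{K}(X_p)$ is the C*-subalgebra generated by the $\theta_{x,y}$. For $p,q\in P$ let $i_p^{pq}:\mathcal{L}(X_p)\to\mathcal{L}(X_{pq})$ be the $*$-homomorphism with $i_p^{pq}(S)(xy)=(Sx)y$ for $x\in X_p$, $y\in X_q$. A product system $X$ over a right LCM semigroup is compactly aligned if $S\vee T:=i_p^r(S)i_q^r(T)\in\mathcal{K}(X_r)$ whenever $S\in\mathcal{K}(X_p)$, $T\in\mathcal{K}(X_q)$ and $pP\cap qP=rP$. Zappa-Szép action of $G$ on $X$: a collection $\beta=\{\beta_g\}_{g\in G}$ of maps on $X$ such that (A1) for each $p\in P$, $g\in G$, $\beta_g$ restricts to a $\mathbb{C}$-linear map $X_p\to X_{g\cdot p}$; (A2) $\beta_g\circ\beta_h=\beta_{gh}$; (A3) $\beta_e$ is the identity; (A4) each $\beta_g$ is a $*$-automorphism of $X_e=\mathcal{A}$; (A5) $\beta_g(xy)=\beta_g(x)\beta_{g|_p}(y)$ for $x\in X_p$, $y\in X_q$;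 (A6) $\langle\beta_g(x),\beta_g(y)\rangle=\beta_{g|_p}(\langle x,y\rangle)$ for $x,y\in X_p$. The triple $(X,G,\beta)$ is then called a Zappa-Szép system. The product system $X\bowtie G$ over $P\bowtie G$ with coefficient $\mathcal{A}$: its fibre over $(p,g)$ is $Y_{(p,g)}=\{x\otimes g:x\in X_p\}$ with $a(x\otimes g)=ax\otimes g$, $(x\otimes g)a=x\beta_g(a)\otimes g$, $\langle x\otimes g,y\otimes g\rangle=\beta_{g^{-1}}(\langle x,y\rangle)$, and multiplication $(x\otimes g)(y\otimes h)=x\beta_g(y)\otimes g|_q h$ for $x\in X_p$, $y\in X_q$; $Y_{(e,e)}$ is identified with $\mathcal{A}$ via $a\otimes e\leftrightarrow a$. When $P$ is right LCM and $X$ is compactly aligned, $X\bowtie G$ is compactly aligned. A (Toeplitz) representation of a product system $X$ over $P$ on a C*-algebra $\mathcal{B}$ is a family $\psi=(\psi_p)_{p\in P}$ of linear maps $\psi_p:X_p\to\mathcal{B}$ such that $\psi_e$ is a $*$-homomorphism, $\psi_p(x)\psi_q(y)=\psi_{pq}(xy)$ for $x\in X_p,y\in X_q$, and $\psi_p(x)^*\psi_p(y)=\psi_e(\langle x,y\rangle)$ for $x,y\in X_p$. It induces homomorphisms $\psi^{(p)}:\mathcal{K}(X_p)\to\mathcal{B}$ with $\psi^{(p)}(\theta_{x,y})=\psi_p(x)\psi_p(y)^*$. Nica covariance. A representation $\psi$ of a compactly aligned product system over a right LCM semigroup $P$ is Nica-covariant if for all $p,q\in P$, $S\in\mathcal{K}(X_p)$,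 $T\in\mathcal{K}(X_q)$: $\psi^{(p)}(S)\psi^{(q)}(T)=\psi^{(r)}(S\vee T)$ if $pP\cap qP=rP$, and $\psi^{(p)}(S)\psi^{(q)}(T)=0$ if $pP\cap qP=\emptyset$ (this does not depend on the choice of $r$). $\mathcal{NT}_X$ denotes the universal C*-algebra generated by the Nica-covariant Toeplitz representations of $X$. A covariant representation of $(X,G,\beta)$ on a unital C*-algebra $\mathcal{B}$ is a pair $(\psi,U)$ of a representation $\psi$ of $X$ on $\mathcal{B}$ and a unitary representation $U$ of $G$ on $\mathcal{B}$ with $U_g\psi_p(x)=\psi_{g\cdot p}(\beta_g(x))U_{g|_p}$ for all $p\in P$, $g\in G$, $x\in X_p$. $\mathcal{NT}_X\bowtie G$ denotes the universal C*-algebra generated by the set of covariant representations $(\psi,U)$ of $(X,G,\beta)$ with $\psi$ Nica-covariant.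
   Formalization: Covariant representations (ψ,U) on a unital C*-algebra are required to have ψ unital, ψ_e(1)=1; without this the claim fails, e.g. for trivial P and G and A=X=ℂ, where NT_{X⋈G}=ℂ but NT_X⋈G=ℂ². *)

(* Defs.v *)
From HB Require Import structures.
From mathcomp Require Import all_boot all_order all_algebra.
From mathcomp Require Import complex ring lra.
From mathcomp Require Import all_classical all_reals all_analysis.

Set Implicit Arguments.
Unset Strict Implicit.
Unset Printing Implicit Defensive.
Import Order.TTheory GRing.Theory Num.Theory.
Import numFieldNormedType.Exports.
Local Open Scope classical_set_scope.
Local Open Scope ring_scope.

Declare Scope cstar_scope.
Delimit Scope cstar_scope with cstar.
Local Open Scope cstar_scope.

Reserved Notation "a ⋆ b" (at level 40, left associativity).
Reserved Notation "⟨ x , y ⟩" (at level 0, x at level 99, y at level 99).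
Reserved Notation "x ◁ a" (at level 40, left associativity).
Reserved Notation "a ▷ x" (at level 40, left associativity).

Record cstar (R : realType) := CStar {
  cs_sort :> completeNormedModType R[i];
  cs_mul : cs_sort -> cs_sort -> cs_sort;
  cs_star : cs_sort -> cs_sort;
  cs_mulA : associative cs_mul;
  cs_linl : forall b, linear (cs_mul^~ b);
  cs_linr : forall a, linear (cs_mul a);
  cs_starK : involutive cs_star;
  cs_starD : {morph cs_star : a b / a + b};
  cs_starZ : forall (k : R[i]) a, cs_star (k *: a) = k^* *: cs_star a;
  cs_starM : forall a b, cs_star (cs_mul a b) = cs_mul (cs_star b) (cs_star a);
  cs_normM : forall a b, `|cs_mul a b| <= `|a| * `|b|;
  cs_normC : forall a, `|cs_mul (cs_star a) a| = `|a| ^+ 2 }.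

Notation "a ⋆ b" := (cs_mul a b) : cstar_scope.

(* The zero algebra is allowed. *)
Record ucstar (R : realType) := UCStar {
  uc_alg :> cstar R;
  uc_one : uc_alg;
  uc_mul1l : left_id uc_one (@cs_mul R uc_alg);
  uc_mul1r : right_id uc_one (@cs_mul R uc_alg) }.

Section CStarAlgebras.
Variable R : realType.

Definition positive (A : cstar R) (a : A) : Prop :=
  exists b : A, a = cs_star b ⋆ b.

Record star_hom (A B : cstar R) (f : A -> B) : Prop := StarHom {
  sh_lin : linear f;
  sh_mul : forall a b, f (a ⋆ b) = f a ⋆ f b;
  sh_star : forall a, f (cs_star a) = cs_star (f a) }.

Definition star_iso (A B : cstar R) (f : A -> B) : Prop :=
  star_hom f /\ bijective f.

Definition isomorphic (A B : cstar R) : Prop :=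
  exists f : A -> B, star_iso f.

Record cstar_subalgebra (A : cstar R) (D : set A) : Prop := CStarSubalgebra {
  sa_zero : D 0;
  sa_lin : forall (k : R[i]) a b, D a -> D b -> D (k *: a + b);
  sa_mul : forall a b, D a -> D b -> D (a ⋆ b);
  sa_star : forall a, D a -> D (cs_star a);
  sa_closed : closed D }.

Definition generated_by (A : cstar R) (S : set A) : Prop :=
  forall D : set A, cstar_subalgebra D -> S `<=` D -> D = setT.

End CStarAlgebras.

(* Inner products are conjugate linear in the first variable. *)
Record hilbert (R : realType) (A : cstar R) := Hilbert {
  hb_sort :> completeNormedModType R[i];
  hb_act : hb_sort -> A -> hb_sort;
  hb_inner : hb_sort -> hb_sort -> A;
  hb_actl : forall a, linear (hb_act^~ a);
  hb_actr : forall x, linear (hb_act x);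
  hb_actM : forall x a b, hb_act x (a ⋆ b) = hb_act (hb_act x a) b;
  hb_innerr : forall x, linear (hb_inner x);
  hb_innerA : forall x y a, hb_inner x (hb_act y a) = hb_inner x y ⋆ a;
  hb_innerC : forall x y, hb_inner y x = cs_star (hb_inner x y);
  hb_pos : forall x, positive (hb_inner x x);
  hb_norm : forall x, `|x| ^+ 2 = `|hb_inner x x| }.

Notation "⟨ x , y ⟩" := (hb_inner x y) : cstar_scope.
Notation "x ◁ a" := (hb_act x a) : cstar_scope.

Section Operators.
Variables (R : realType) (A : cstar R).

Definition is_adjoint (E F : hilbert A) (S : E -> F) (S' : F -> E) : Prop :=
  forall x y, ⟨S x, y⟩ = ⟨x, S' y⟩.

Definition adjointable (E F : hilbert A) (S : E -> F) : Prop :=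
  exists S', is_adjoint S S'.

Definition unitary (E F : hilbert A) (M : E -> F) : Prop :=
  exists M', [/\ is_adjoint M M', cancel M M' & cancel M' M].

Definition theta (E : hilbert A) (x y : E) : E -> E := fun z => x ◁ ⟨y, z⟩.

(* C*-subalgebras of L(E); closedness is for the operator norm. *)
Record op_subalgebra (E : hilbert A) (D : set (E -> E)) : Prop :=
  OpSubalgebra {
  os_adjointable : forall S, D S -> adjointable S;
  os_zero : D (fun=> 0);
  os_lin : forall (k : R[i]) S T, D S -> D T -> D (fun x => k *: S x + T x);
  os_comp : forall S T, D S -> D T -> D (S \o T);
  os_adj : forall S S', D S -> is_adjoint S S' -> D S';
  os_closed : forall S, adjointable S ->
    (forall e : R[i], 0 < e ->
       exists2 T, D T & forall x, `|S x - T x| <= e * `|x|) -> D S }.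

(* S lies in K(E), the C*-subalgebra of L(E) generated by the theta x y. *)
Definition compact_op (E : hilbert A) (S : E -> E) : Prop :=
  forall D : set (E -> E), op_subalgebra D -> (forall x y, D (theta x y)) ->
    D S.

End Operators.

Record corr (R : realType) (A : cstar R) := Corr {
  co_hilb :> hilbert A;
  co_act : A -> co_hilb -> co_hilb;
  co_adj : forall a, is_adjoint (co_act a) (co_act (cs_star a));
  co_actl : forall x, linear (co_act^~ x);
  co_actM : forall a b x, co_act (a ⋆ b) x = co_act a (co_act b x) }.

Notation "a ▷ x" := (co_act a x) : cstar_scope.

Section Correspondences.
Variables (R : realType) (A : cstar R).

Definition regular_hilbert : hilbert A.
Proof.
refine (@Hilbert R A (cs_sort A) (@cs_mul R A)
  (fun a b => cs_star a ⋆ b) _ _ _ _ _ _ _ _).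
- by move=> a; exact: cs_linl.
- by move=> a; exact: cs_linr.
- by move=> *; rewrite cs_mulA.
- by move=> a; exact: cs_linr.
- by move=> *; rewrite cs_mulA.
- by move=> *; rewrite cs_starM cs_starK.
- by move=> x; exists x.
- by move=> x; rewrite cs_normC.
Defined.

Definition regular : corr A.
Proof.
refine (@Corr R A regular_hilbert (@cs_mul R A) _ _ _).
- by move=> a x y /=; rewrite cs_starM cs_mulA.
- by move=> x; exact: cs_linl.
- by move=> *; rewrite cs_mulA.
Defined.

Definition corr_iso (E F : corr A) (M : E -> F) : Prop :=
  unitary M /\ forall a x, M (a ▷ x) = a ▷ M x.

(* [tensor_of t]: the pairing t exhibits Z as the interior tensor product of
   E and F over A; this determines (Z, t) up to a unique unitary. *)
Record tensor_of (E : hilbert A) (F : corr A) (Z : hilbert A)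
    (t : E -> F -> Z) : Prop := TensorOf {
  te_linl : forall y, linear (t^~ y);
  te_linr : forall x, linear (t x);
  te_balanced : forall x a y, t (x ◁ a) y = t x (a ▷ y);
  te_act : forall x y a, t x (y ◁ a) = t x y ◁ a;
  te_inner : forall x y x' y', ⟨t x y, t x' y'⟩ = ⟨y, ⟨x, x'⟩ ▷ y'⟩;
  te_dense : dense [set z | exists n (x : 'I_n -> E) (y : 'I_n -> F),
                              z = \sum_i t (x i) (y i)] }.

End Correspondences.

(* X is the disjoint union of its fibres; elements of fibres over provably
   (but not definitionally) equal indices are compared in this union. *)
Definition in_total (I : Type) (F : I -> Type) (i : I) (x : F i) :
  {i : I & F i} := existT F i x.
Notation tot X x := (@in_total _ (fun p => hb_sort (co_hilb (X p))) _ x).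

Record product_system (R : realType) (P : monoidType) (A : cstar R) :=
  ProductSystem {
  ps_fib :> P -> corr A;
  ps_mul : forall p q, ps_fib p -> ps_fib q -> ps_fib (p * q)%g;
  ps_mulA : forall p q r (x : ps_fib p) (y : ps_fib q) (z : ps_fib r),
    tot ps_fib (ps_mul x (ps_mul y z)) = tot ps_fib (ps_mul (ps_mul x y) z);
  (* the identification of A with the fibre over the identity *)
  ps_coef : A -> ps_fib 1%g;
  ps_coef_iso : corr_iso (ps_coef : regular A -> ps_fib 1%g);
  ps_mul_unitary : forall p q,
    exists (Z : hilbert A) (t : ps_fib p -> ps_fib q -> Z)
           (M : Z -> ps_fib (p * q)%g),
      [/\ tensor_of t, unitary M & forall x y, M (t x y) = ps_mul x y];
  ps_coef_mull : forall p a (x : ps_fib p),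
    tot ps_fib (ps_mul (ps_coef a) x) = tot ps_fib (a ▷ x);
  ps_coef_mulr : forall p a (x : ps_fib p),
    tot ps_fib (ps_mul x (ps_coef a)) = tot ps_fib (x ◁ a) }.

Section RightLCM.
Variable P : monoidType.

Definition rideal (p : P) : set P := [set (p * q)%g | q in [set: P]].

Definition right_lcm : Prop :=
  (forall p q r : P, (p * q = p * r)%g -> q = r) /\
  (forall p q : P, rideal p `&` rideal q = set0 \/
                   exists r, rideal p `&` rideal q = rideal r).

End RightLCM.

Section Nica.
Variables (R : realType) (P : monoidType) (A : cstar R).
Variable X : product_system P A.

(* The graph of i_p^r, for r in pP: S' = i_p^r(S). Such an S' is unique, since
   products span a dense subspace, and it exists (it is S (x) 1 up to the
   unitary M_{p,q}). *)
Definition amplifies p r (S : X p -> X p) (S' : X r -> X r) : Prop :=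
  adjointable S' /\
  forall q (x : X p) (y : X q) (z w : X r),
    tot X z = tot X (ps_mul x y) -> tot X w = tot X (ps_mul (S x) y) ->
    S' z = w.

(* V = S \/ T, for pP `&` qP = rP *)
Definition is_join p q r (S : X p -> X p) (T : X q -> X q) (V : X r -> X r) :
    Prop :=
  exists S' T', [/\ amplifies S S', amplifies T T' & V = S' \o T'].

Definition compactly_aligned : Prop :=
  forall p q r (S : X p -> X p) (T : X q -> X q) (V : X r -> X r),
    rideal p `&` rideal q = rideal r -> compact_op S -> compact_op T ->
    is_join S T V -> compact_op V.

Variable B : cstar R.

Record representation (psi : forall p, X p -> B) : Prop := Representation {
  re_lin : forall p, linear (psi p);
  re_coef : star_hom (fun a => psi 1%g (ps_coef X a));
  re_mul : forall p q (x : X p) (y : X q),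
    psi p x ⋆ psi q y = psi (p * q)%g (ps_mul x y);
  re_inner : forall p (x y : X p),
    cs_star (psi p x) ⋆ psi p y = psi 1%g (ps_coef X ⟨x, y⟩) }.

(* f is (on K(X_p)) the *-homomorphism induced by psi; the values of f outside
   K(X_p) are irrelevant. *)
Record induced p (psi : X p -> B) (f : (X p -> X p) -> B) : Prop := Induced {
  in_lin : forall (k : R[i]) S T, compact_op S -> compact_op T ->
    f (fun x => k *: S x + T x) = k *: f S + f T;
  in_mul : forall S T, compact_op S -> compact_op T ->
    f (S \o T) = f S ⋆ f T;
  in_star : forall S S', compact_op S -> is_adjoint S S' ->
    f S' = cs_star (f S);
  in_theta : forall x y, f (theta x y) = psi x ⋆ cs_star (psi y) }.

(* The family f is the family of the psi^(p); each psi^(p) always exists and is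
   determined on K(X_p) by its values on the theta x y. *)
Definition nica_covariant (psi : forall p, X p -> B) : Prop :=
  exists2 f : forall p, (X p -> X p) -> B, forall p, induced (psi p) (f p) &
    forall p q (S : X p -> X p) (T : X q -> X q),
      compact_op S -> compact_op T ->
      (forall r (V : X r -> X r), rideal p `&` rideal q = rideal r ->
         is_join S T V -> f p S ⋆ f q T = f r V) /\
      (rideal p `&` rideal q = set0 -> f p S ⋆ f q T = 0).

End Nica.

(* (N, psi) is NT_X with its universal representation *)
Record is_NT (R : realType) (P : monoidType) (A : cstar R)
    (X : product_system P A) (N : cstar R) (psi : forall p, X p -> N) : Prop :=
  IsNT {
  nt_rep : representation psi;
  nt_nica : nica_covariant psi;
  nt_gen : generated_by [set b | exists p (x : X p), b = psi p x];
  nt_univ : forall (B : cstar R) (phi : forall p, X p -> B),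
    representation phi -> nica_covariant phi ->
    exists2 h : N -> B, star_hom h & forall p x, h (psi p x) = phi p x }.

(* [zs_res p g] is g|_p. *)
Record zappa_szep (P : monoidType) (G : groupType) := ZappaSzep {
  zs_act : G -> P -> P;
  zs_res : P -> G -> G;
  zs_act1 : forall p, zs_act 1%g p = p;
  zs_actM : forall g h p, zs_act (g * h)%g p = zs_act g (zs_act h p);
  zs_acte : forall g, zs_act g 1%g = 1%g;
  zs_rese : forall g, zs_res 1%g g = g;
  zs_actD : forall g p q,
    zs_act g (p * q)%g = (zs_act g p * zs_act (zs_res p g) q)%g;
  zs_resD : forall g p q, zs_res (p * q)%g g = zs_res q (zs_res p g);
  zs_res1 : forall p, zs_res p 1%g = 1%g;
  zs_resM : forall g h p,
    zs_res p (g * h)%g = (zs_res (zs_act h p) g * zs_res p h)%g }.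

Section Bowtie.
Variables (P : monoidType) (G : groupType) (Z : zappa_szep P G).

(* An alias, since P * G already carries the direct product structure. *)
Definition bowtie of zappa_szep P G : Type := (P * G)%type.

Definition bowtie_mul (a b : bowtie Z) : bowtie Z :=
  ((a.1 * zs_act Z a.2 b.1)%g, (zs_res Z b.1 a.2 * b.2)%g).

Definition bowtie_one : bowtie Z := (1%g, 1%g).

Lemma bowtie_mulA : associative bowtie_mul.
Proof.
move=> [p g] [q h] [r k]; rewrite /bowtie_mul /=; congr pair.
  by rewrite zs_actD zs_actM mulgA.
by rewrite zs_resD zs_resM mulgA.
Qed.

Lemma bowtie_mul1l : left_id bowtie_one bowtie_mul.
Proof. by move=> [p g]; rewrite /bowtie_mul /= zs_act1 zs_res1 !mul1g. Qed.

Lemma bowtie_mul1r : right_id bowtie_one bowtie_mul.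
Proof. by move=> [p g]; rewrite /bowtie_mul /= zs_acte zs_rese !mulg1. Qed.

HB.instance Definition _ := Choice.copy (bowtie Z) (P * G)%type.
HB.instance Definition _ :=
  isMonoid.Build (bowtie Z) bowtie_mulA bowtie_mul1l bowtie_mul1r.

End Bowtie.

Record zs_action (R : realType) (P : monoidType) (G : groupType)
    (Z : zappa_szep P G) (A : cstar R) (X : product_system P A) := ZSAction {
  za_map : forall g p, X p -> X (zs_act Z g p);
  (* beta_g on the fibre over the identity, read as a map on A *)
  za_coef : G -> A -> A;
  za_lin : forall g p, linear (@za_map g p);
  za_comp : forall g h p (x : X p),
    tot X (za_map g (za_map h x)) = tot X (za_map (g * h)%g x);
  za_id : forall p (x : X p), tot X (za_map 1%g x) = tot X x;
  za_coefE : forall g a,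
    tot X (za_map g (ps_coef X a)) = tot X (ps_coef X (za_coef g a));
  za_auto : forall g, star_iso (za_coef g);
  za_mul : forall g p q (x : X p) (y : X q),
    tot X (za_map g (ps_mul x y)) =
    tot X (ps_mul (za_map g x) (za_map (zs_res Z p g) y));
  za_inner : forall g p (x y : X p),
    ⟨za_map g x, za_map g y⟩ = za_coef (zs_res Z p g) ⟨x, y⟩ }.

Section Covariant.
Variables (R : realType) (P : monoidType) (G : groupType).
Variables (Z : zappa_szep P G) (A : ucstar R) (X : product_system P A).
Variable beta : zs_action Z X.

Record unitary_rep (B : ucstar R) (U : G -> B) : Prop := UnitaryRep {
  ur_mul : forall g h, U (g * h)%g = U g ⋆ U h;
  ur_starl : forall g, cs_star (U g) ⋆ U g = uc_one B;
  ur_starr : forall g, U g ⋆ cs_star (U g) = uc_one B }.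

(* As usual for unital coefficients acting on a unital algebra, psi is unital.
   Otherwise psi = 0 with an arbitrary U would be allowed, and the universal
   algebra would acquire a spurious summand coming from G alone. *)
Record covariant_rep (B : ucstar R) (psi : forall p, X p -> B) (U : G -> B) :
    Prop := CovariantRep {
  cr_rep : representation psi;
  cr_unital : psi 1%g (ps_coef X (uc_one A)) = uc_one B;
  cr_unitary : unitary_rep U;
  cr_cov : forall p g (x : X p),
    U g ⋆ psi p x =
    psi (zs_act Z g p) (za_map beta g x) ⋆ U (zs_res Z p g) }.

(* (N, psi, U) is NT_X >< G with its universal covariant representation *)
Record is_NT_bowtie (N : ucstar R) (psi : forall p, X p -> N) (U : G -> N) :
    Prop := IsNTBowtie {
  nb_cov : covariant_rep psi U;
  nb_nica : nica_covariant psi;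
  nb_gen : generated_by
    [set b | (exists p (x : X p), b = psi p x) \/ (exists g, b = U g)];
  nb_univ : forall (B : ucstar R) (phi : forall p, X p -> B) (V : G -> B),
    covariant_rep phi V -> nica_covariant phi ->
    exists h : N -> B, [/\ star_hom h, forall p x, h (psi p x) = phi p x
                                     & forall g, h (U g) = V g] }.

End Covariant.

Section CStarTheory.
Variables (R : realType) (A : cstar R).
Implicit Types a b c : A.

Lemma cs_mulDl a b c : (a + b) ⋆ c = a ⋆ c + b ⋆ c.
Proof. by have := cs_linl c 1 a b; rewrite /= !scale1r. Qed.

Lemma cs_mulDr a b c : a ⋆ (b + c) = a ⋆ b + a ⋆ c.
Proof. by have := cs_linr a 1 b c; rewrite /= !scale1r. Qed.

Lemma cs_mul0l a : 0 ⋆ a = 0.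
Proof. by apply: (addrI (0 ⋆ a)); rewrite -cs_mulDl !addr0. Qed.

Lemma cs_mul0r a : a ⋆ 0 = 0.
Proof. by apply: (addrI (a ⋆ 0)); rewrite -cs_mulDr !addr0. Qed.

Lemma cs_mulZl (k : R[i]) a b : (k *: a) ⋆ b = k *: (a ⋆ b).
Proof. by have := cs_linl b k a 0; rewrite /= !addr0 cs_mul0l addr0. Qed.

Lemma cs_mulZr (k : R[i]) a b : a ⋆ (k *: b) = k *: (a ⋆ b).
Proof. by have := cs_linr a k b 0; rewrite /= !addr0 cs_mul0r addr0. Qed.

Lemma cs_mulNl a b : (- a) ⋆ b = - (a ⋆ b).
Proof. by rewrite -scaleN1r cs_mulZl scaleN1r. Qed.

Lemma cs_mulNr a b : a ⋆ (- b) = - (a ⋆ b).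
Proof. by rewrite -scaleN1r cs_mulZr scaleN1r. Qed.

Lemma cs_star0 : cs_star (0 : A) = 0.
Proof. by apply: (addrI (cs_star 0)); rewrite -cs_starD !addr0. Qed.

Lemma cs_starN a : cs_star (- a) = - cs_star a.
Proof. by apply: (addrI (cs_star a)); rewrite -cs_starD !subrr cs_star0. Qed.

Lemma cs_norm_star a : `|cs_star a| = `|a|.
Proof.
suff h b : `|b| <= `|cs_star b|.
  by apply: le_anti; rewrite h -{2}(cs_starK a) h.
have [->|b0] := eqVneq b 0; first by rewrite normr0.
have := cs_normM (cs_star b) b; rewrite cs_normC expr2.
by rewrite ler_pM2r // normr_gt0.
Qed.

Lemma norm_small0 a (K : R[i]) : 0 <= K ->
  (forall e : R[i], 0 < e -> `|a| <= K * e) -> a = 0.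
Proof.
move=> K0 h; apply/eqP; rewrite -normr_le0; apply/ler_addgt0Pr => e e0.
rewrite add0r; have K1 : 0 < K + 1 by rewrite ltr_wpDl.
apply: (le_trans (h (e / (K + 1)) _)); first by rewrite divr_gt0.
rewrite mulrCA -[leRHS]mulr1 ler_pM2l // ler_pdivrMr // mul1r.
by rewrite lerDl ler01.
Qed.

Lemma geometric_cvg (c : nat -> A) (r : R) : 0 <= r < 1 ->
    (forall n, `|c n.+1 - c n| <= (r ^+ n)%:C%C) ->
  exists l, forall e : R[i], 0 < e -> exists n, forall m, (n <= m)%N ->
    `|l - c m| < e.
Proof.
move=> /andP[r0 r1] hc.
have d0 : 0 < 1 - r by rewrite subr_gt0.
have hd n m : `|c n - c (n + m)%N| <= (r ^+ n / (1 - r))%:C%C.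
  suff : `|c n - c (n + m)%N| <= (r ^+ n * (1 - r ^+ m) / (1 - r))%:C%C.
    move=> /le_trans; apply; rewrite lecR ler_pM2r ?invr_gt0 //.
    by rewrite ler_piMr ?exprn_ge0 // gerBl exprn_ge0.
  elim: m => [|m ih].
    by rewrite addn0 subrr normr0 expr0 subrr mulr0 mul0r.
  rewrite -[c n](subrK (c (n + m)%N)) -addrA.
  apply: (le_trans (ler_normD _ _)); apply: (le_trans (lerD ih _)).
    by rewrite distrC addnS; exact: hc.
  rewrite -rmorphD /= lecR le_eqVlt; apply/orP; left; apply/eqP.
  rewrite exprD exprS; field; exact: lt0r_neq0.
have small (e : R) : 0 < e ->
    exists n, forall m, (n <= m)%N -> r ^+ m / (1 - r) < e.
  move=> e0; have := @cvg_geometric R (1 - r)^-1 r.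
  rewrite ger0_norm // => /(_ r1) /cvgrPdist_lt /(_ _ e0) [n _ hn].
  exists n => m nm; have := hn m nm; rewrite /geometric /= sub0r normrN.
  by rewrite ger0_norm 1?mulrC // mulr_ge0 ?exprn_ge0 // invr_ge0 ltW.
have complexE (e : R[i]) : 0 < e -> exists2 e' : R, 0 < e' & e = (e'%:C)%C.
  by case: e => x y; rewrite ltcE /= => /andP[/eqP -> x0]; exists x.
have : cvgn c.
  apply/cauchy_cvgP/cauchy_ballP => e /complexE [e' e0 ->].
  have [n hn] := small _ (divr_gt0 e0 (ltr0n _ 2)).
  near_simpl.
  exists ([set m | (n <= m)%N], [set m | (n <= m)%N]).
    by split; exists n.
  move=> [m1 m2] /= [h1 h2]; rewrite -ball_normE /=.
  have bound m : (n <= m)%N -> `|c n - c m| < ((e' / 2)%:C)%C.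
    move=> nm; rewrite -(subnKC nm); apply: (le_lt_trans (hd _ _)).
    by rewrite ltcR hn.
  rewrite -[c m1](subrK (c n)) -addrA.
  apply: (le_lt_trans (ler_normD _ _)).
  rewrite [e']splitr rmorphD /= ltrD ?bound //.
  by rewrite distrC bound.
move=> /cvg_ex [l hl]; exists l => e e0.
by have /cvgrPdist_lt /(_ _ e0) [n _ hn] := hl; exists n => m; exact: hn.
Qed.

Lemma sqrt_fixpoint a : cs_star a = a -> `|a| < 1 ->
  exists c, [/\ cs_star c = c, a ⋆ c = c ⋆ a & c + c = a ⋆ a + c ⋆ c].
Proof.
move=> sa a1; set x := a ⋆ a.
pose r := complex.Re `|a|.
have rE : `|a| = (r%:C)%C by rewrite RRe_real // normr_real.
have r0 : 0 <= r by have := normr_ge0 a; rewrite rE lecR.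
have r1 : r < 1 by move: a1; rewrite rE -[1]/((1 : R)%:C%C) ltcR.
have xr : `|x| <= (r%:C)%C.
  apply: (le_trans (cs_normM _ _)); rewrite rE -rmorphM lecR.
  by rewrite ler_piMr // ltW.
pose h : R[i] := ((2^-1 : R)%:C)%C.
have h0 : 0 <= h by rewrite lecR invr_ge0 ler0n.
have hh u : h *: u + h *: u = u.
  by rewrite -scalerDl -rmorphD /= -div1r -splitr scale1r.
have h2 : h * 2 = 1.
  rewrite -[2](rmorph_nat (real_complex R)) -(rmorphM (real_complex R)).
  by rewrite mulVf ?rmorph1 // pnatr_eq0.
have ch : h^* = h by apply/CrealP; rewrite ger0_real.
pose f u := h *: (x + u ⋆ u).
pose c n := iter n f 0.
have fnorm u v : `|u| <= (r%:C)%C -> `|v| <= (r%:C)%C ->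
    `|f u - f v| <= (r%:C)%C * `|u - v|.
  move=> hu hv; rewrite /f -scalerBr normrZ ger0_norm //.
  rewrite opprD addrACA subrr add0r.
  have -> : u ⋆ u - v ⋆ v = u ⋆ (u - v) + (u - v) ⋆ v.
    by rewrite cs_mulDr cs_mulDl cs_mulNl cs_mulNr addrA subrK.
  have -> : (r%:C)%C * `|u - v| =
      h * ((r%:C)%C * `|u - v| + `|u - v| * (r%:C)%C).
    rewrite [`|_| * _]mulrC -mulr2n -mulr_natl mulrA.
    by rewrite !mulrA h2 mul1r.
  apply: ler_wpM2l => //; apply: (le_trans (ler_normD _ _)).
  by apply: lerD; apply: (le_trans (cs_normM _ _)); rewrite ler_pM.
have cr n : `|c n| <= (r%:C)%C.
  elim: n => [|n ih]; first by rewrite normr0 lecR.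
  rewrite /= -/(c n) normrZ ger0_norm //.
  apply: (@le_trans _ _ (h * ((r + r * r)%:C)%C)).
    apply: ler_wpM2l => //; apply: (le_trans (ler_normD _ _)).
    rewrite rmorphD rmorphM; apply: lerD => //.
    by apply: (le_trans (cs_normM _ _)); rewrite ler_pM.
  rewrite -rmorphM lecR mulrC ler_pdivrMr ?ltr0n // mulr_natr mulr2n.
  by rewrite lerD2l ler_piMr // ltW.
have cd n : `|c n.+1 - c n| <= (r ^+ n)%:C%C.
  elim: n => [|n ih].
    rewrite subr0 expr0; apply: (le_trans (cr 1%N)).
    by rewrite lecR ltW.
  apply: (le_trans (fnorm (c n.+1) (c n) (cr _) (cr _))).
  by rewrite exprS rmorphM; apply: ler_wpM2l; rewrite ?lecR.
have r01 : 0 <= r < 1 by rewrite r0.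
have [l hl] := geometric_cvg r01 cd.
have star_c n : cs_star (c n) = c n.
  elim: n => [|n ih]; first exact: cs_star0.
  by rewrite /= -/(c n) /f cs_starZ cs_starD !cs_starM sa ih ch.
have comm_c n : a ⋆ c n = c n ⋆ a.
  elim: n => [|n ih]; first by rewrite cs_mul0l cs_mul0r.
  rewrite /= -/(c n) /f cs_mulZl cs_mulZr cs_mulDl cs_mulDr.
  by rewrite /x cs_mulA (cs_mulA a) ih -!cs_mulA ih.
exists l; split.
- apply/eqP; rewrite -subr_eq0; apply/eqP.
  apply: (@norm_small0 _ 2) => // e e0; have [n hn] := hl _ e0.
  rewrite -[l in cs_star l](subrK (c n)) cs_starD star_c.
  rewrite -addrA -(opprB l); apply: (le_trans (ler_normB _ _)).
  rewrite cs_norm_star.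
  by rewrite mulr_natl mulr2n lerD // ltW // hn.
- apply/eqP; rewrite -subr_eq0; apply/eqP.
  apply: (@norm_small0 _ (`|a| + `|a|)) => [|e e0].
    by rewrite addr_ge0.
  have [n hn] := hl _ e0.
  rewrite -[l](subrK (c n)) cs_mulDl cs_mulDr comm_c opprD.
  rewrite addrACA subrr addr0; apply: (le_trans (ler_normB _ _)).
  rewrite mulrDl.
  apply: lerD; apply: (le_trans (cs_normM _ _)).
    by apply: ler_wpM2l => //; rewrite ltW // hn.
  by rewrite mulrC; apply: ler_wpM2l => //; rewrite ltW // hn.
- apply/eqP; rewrite -subr_eq0; apply/eqP.
  pose L := `|l| + (r%:C)%C.
  have L0 : 0 <= L by rewrite addr_ge0 // lecR.
  apply: (@norm_small0 _ (2 + L)) => [|e e0]; first by rewrite addr_ge0.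
  have [n hn] := hl _ e0.
  have e1 : x = c n.+1 + c n.+1 - c n ⋆ c n by rewrite /= /f hh addrK.
  have -> : l + l - (x + l ⋆ l) =
      (l - c n.+1) + (l - c n.+1) - (l ⋆ (l - c n) + (l - c n) ⋆ c n).
    have -> : l ⋆ (l - c n) + (l - c n) ⋆ c n = l ⋆ l - c n ⋆ c n.
      by rewrite cs_mulDr cs_mulDl cs_mulNl cs_mulNr addrA subrK.
    have -> : (l - c n.+1) + (l - c n.+1) = l + l - (c n.+1 + c n.+1).
      by rewrite addrACA -opprD.
    rewrite e1 -[RHS]addrA -opprD; congr (_ - _).
    by rewrite addrAC -addrA.
  apply: (le_trans (ler_normB _ _)); rewrite mulrDl; apply: lerD.
    rewrite mulr_natl mulr2n; apply: (le_trans (ler_normD _ _)).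
    by rewrite lerD // ltW // hn.
  apply: (le_trans (ler_normD _ _)); rewrite mulrDl; apply: lerD.
    apply: (le_trans (cs_normM _ _)); apply: ler_wpM2l => //.
    by rewrite ltW // hn.
  apply: (le_trans (cs_normM _ _)); rewrite mulrC.
  by apply: ler_pM => //; rewrite ltW // hn.
Qed.

End CStarTheory.

Section Isometry.
Variables (R : realType) (A : ucstar R).

Lemma uc_norm1 : `|uc_one A| <= 1.
Proof.
have s1 : cs_star (uc_one A) = uc_one A.
  rewrite -[LHS]uc_mul1l -{1}[uc_one A]cs_starK -cs_starM uc_mul1l.
  exact: cs_starK.
have := cs_normC (uc_one A); rewrite s1 uc_mul1l expr2.
have [->|n0] := eqVneq `|uc_one A| 0; first by rewrite ler01.
by move=> /esym /(canRL (mulfK n0)); rewrite mulfV // => ->.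
Qed.

Lemma star_auto_contract (f : A -> A) : star_iso f ->
  forall a, `|f a| <= `|a|.
Proof.
case=> [[fl fM fS] [g fK gK]].
have fD u v : f (u + v) = f u + f v by have := fl 1 u v; rewrite !scale1r.
have f0 : f 0 = 0 by apply: (addrI (f 0)); rewrite -fD !addr0.
have fZ (k : R[i]) u : f (k *: u) = k *: f u.
  by have := fl k u 0; rewrite f0 !addr0.
have f1 : f (uc_one A) = uc_one A.
  by rewrite -[LHS]uc_mul1r -{2}(gK (uc_one A)) -fM uc_mul1l gK.
have s1 : cs_star (uc_one A) = uc_one A.
  rewrite -[LHS]uc_mul1l -{1}[uc_one A]cs_starK -cs_starM uc_mul1l.
  exact: cs_starK.
have small a : cs_star a = a -> `|a| < 1 -> `|f a| <= 1.
  move=> sa a1; have [c [sc ac cc]] := sqrt_fixpoint sa a1.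
  pose b := uc_one A - c.
  have sb : cs_star b = b by rewrite cs_starD cs_starN s1 sc.
  have ab : a ⋆ b = b ⋆ a.
    by rewrite cs_mulDl cs_mulDr cs_mulNl cs_mulNr uc_mul1l uc_mul1r ac.
  have bb : a ⋆ a + b ⋆ b = uc_one A.
    have -> : b ⋆ b = uc_one A - (c + c) + c ⋆ c.
      rewrite cs_mulDl !cs_mulDr !cs_mulNl !cs_mulNr !uc_mul1l uc_mul1r opprK.
      by rewrite opprD !addrA.
    by rewrite cc opprD [uc_one A + (_ + _)]addrA subrK addrCA subrr addr0.
  pose s := f a; pose t := f b; pose u := s + 'i *: t.
  have ss : cs_star s = s by rewrite -fS sa.
  have st : cs_star t = t by rewrite -fS sb.
  have su : cs_star u = s - 'i *: t.
    by rewrite cs_starD cs_starZ ss st conjCi scaleNr.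
  have ts : t ⋆ s = s ⋆ t by rewrite -!fM ab.
  have uu : cs_star u ⋆ u = uc_one A.
    rewrite su cs_mulDl !cs_mulDr cs_mulNl cs_mulNl !cs_mulZl !cs_mulZr.
    rewrite ts scalerA -expr2 sqrCi scaleN1r opprK.
    by rewrite addrA addrK -!fM -fD bb.
  have u1 : `|u| <= 1.
    have : `|u| ^+ 2 <= 1 by rewrite -cs_normC uu uc_norm1.
    by rewrite expr_le1.
  have -> : f a = 2^-1 *: (u + cs_star u).
    rewrite su addrACA subrr addr0.
    have -> : s + s = (2 : R[i]) *: s by rewrite scaler_nat mulr2n.
    by rewrite scalerA mulVf ?scale1r // pnatr_eq0.
  rewrite normrZ ger0_norm ?invr_ge0 // mulrC ler_pdivrMr // mul1r.
  apply: (le_trans (ler_normD _ _)); rewrite cs_norm_star.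
  by rewrite -[2]/(1 + 1) lerD.
have sa_contract a : cs_star a = a -> `|f a| <= `|a|.
  move=> sa; rewrite real_leNgt ?normr_real //; apply/negP => lt.
  have [e1 e2] := midf_lt lt.
  set m := (_ + _) / 2 in e1 e2.
  have m0 : 0 < m := le_lt_trans (normr_ge0 a) e1.
  have := small (m^-1 *: a); rewrite cs_starZ sa fZ !normrZ.
  have mr : m^-1^* = m^-1 by apply/CrealP; rewrite realV gtr0_real.
  rewrite mr normfV gtr0_norm // ![m^-1 * _]mulrC ltr_pdivrMr // mul1r.
  rewrite ler_pdivrMr // mul1r => /(_ erefl e1) h.
  by have := le_lt_trans h e2; rewrite ltxx.
move=> a.
have : `|f a| ^+ 2 <= `|a| ^+ 2.
  rewrite -!cs_normC -fS -fM; apply: sa_contract.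
  by rewrite cs_starM cs_starK.
by rewrite ler_pXn2r // nnegrE.
Qed.

Lemma star_auto_isometry (f : A -> A) : star_iso f ->
  forall a, `|f a| = `|a|.
Proof.
move=> fA a; have [[fl fM fS] [g fK gK]] := fA.
apply: le_anti; rewrite star_auto_contract //=.
rewrite -{1}(fK a); apply: star_auto_contract; split; last by exists f.
split.
- by move=> k u v; apply: (can_inj fK); rewrite fl !gK.
- by move=> u v; apply: (can_inj fK); rewrite fM !gK.
- by move=> u; apply: (can_inj fK); rewrite fS !gK.
Qed.

End Isometry.
Section HilbertTheory.
Variables (R : realType) (A : cstar R).

Lemma hb_innerDr (E : hilbert A) (x y z : E) : ⟨x, y + z⟩ = ⟨x, y⟩ + ⟨x, z⟩.
Proof. by have := hb_innerr x 1 y z; rewrite !scale1r. Qed.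

Lemma hb_inner0 (E : hilbert A) (x : E) : (forall y, ⟨y, x⟩ = 0) -> x = 0.
Proof.
move=> h; have := hb_norm x; rewrite h normr0 => /eqP.
by rewrite expf_eq0 /= normr_eq0 => /eqP.
Qed.

Lemma hb_inner_inj (E : hilbert A) (x y : E) :
  (forall z, ⟨z, x⟩ = ⟨z, y⟩) -> x = y.
Proof.
move=> h; apply/eqP; rewrite -subr_eq0; apply/eqP/hb_inner0 => z.
by rewrite -scaleN1r addrC hb_innerr h scaleN1r addNr.
Qed.

Lemma unitary_inner (E F : hilbert A) (M : E -> F) : unitary M ->
  forall x y, ⟨M x, M y⟩ = ⟨x, y⟩.
Proof. by move=> [M' [adj MK M'K]] x y; rewrite adj MK. Qed.

Lemma unitary_surj (E F : hilbert A) (M : E -> F) : unitary M ->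
  forall y, exists x, M x = y.
Proof. by move=> [M' [adj MK M'K]] y; exists (M' y). Qed.

Lemma unitary_lin (E F : hilbert A) (M : E -> F) : unitary M -> linear M.
Proof.
move=> uM k u v; apply: hb_inner_inj => w.
have [z <-] := unitary_surj uM w.
by rewrite hb_innerr !(unitary_inner uM) hb_innerr.
Qed.

Lemma unitary_act (E F : hilbert A) (M : E -> F) : unitary M ->
  forall x a, M (x ◁ a) = M x ◁ a.
Proof.
move=> uM x a; apply: hb_inner_inj => w.
have [z <-] := unitary_surj uM w.
by rewrite hb_innerA !(unitary_inner uM) hb_innerA.
Qed.

Lemma unitary_norm (E F : hilbert A) (M : E -> F) : unitary M ->
  forall x, `|M x| = `|x|.
Proof.
move=> uM x; apply/eqP; rewrite -(eqrXn2 (isT : 0 < 2)%N) ?normr_ge0 //.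
by rewrite !hb_norm (unitary_inner uM).
Qed.

Lemma tensor_of_unitary (E : hilbert A) (F : corr A) (T T' : hilbert A)
    (t : E -> F -> T) (M : T -> T') :
  tensor_of t -> unitary M -> tensor_of (fun x y => M (t x y)).
Proof.
move=> [tl tr tb ta ti td] uM; have Ml := unitary_lin uM.
have MD u v : M (u + v) = M u + M v by have := Ml 1 u v; rewrite !scale1r.
have M0 : M 0 = 0 by apply: (addrI (M 0)); rewrite -MD !addr0.
have MN u : M (- u) = - M u.
  by apply: (addrI (M u)); rewrite -MD !subrr.
split.
- by move=> y k u v /=; have /= -> := tl y k u v; exact: Ml.
- by move=> x k u v /=; have /= -> := tr x k u v; exact: Ml.
- by move=> x a y; rewrite tb.
- by move=> x y a; rewrite ta (unitary_act uM).
- by move=> x y x' y'; rewrite (unitary_inner uM) ti.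
- move=> O [w Ow] oO.
  have [v Mv] := unitary_surj uM w.
  have /td : (M @^-1` O) !=set0 by exists v; rewrite /= Mv.
  case.
    apply: open_comp => // u _; apply/cvgrPdist_lt => e e0.
    near=> z; rewrite -MN -MD (unitary_norm uM).
    near: z; exact: cvgr_dist_lt.
  move=> s [Os [n [x [y sE]]]].
  exists (M s); split=> //; exists n, x, y.
  by rewrite sE (big_morph M MD M0).
Unshelve. all: by end_near. Qed.

End HilbertTheory.

Section Total.
Variables (R : realType) (P : monoidType) (A : cstar R).
Variable X : product_system P A.

Lemma tot_inj p (x y : X p) : tot X x = tot X y -> x = y.
Proof.
by apply: (@Eqdep_dec.inj_pair2_eq_dec P) => a b; case: (eqVneq a b); [left|right; apply/eqP].
Qed.

Lemma tot_cast p q : p = q -> forall x : X p, exists y : X q, tot X y = tot X x.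
Proof. by move=> <- x; exists x. Qed.

Lemma tot_mul p q p' q' (x : X p) (y : X q) (x' : X p') (y' : X q') :
  tot X x = tot X x' -> tot X y = tot X y' ->
  tot X (ps_mul x y) = tot X (ps_mul x' y').
Proof.
pose m (u v : {p : P & X p}) := tot X (ps_mul (projT2 u) (projT2 v)).
by move=> ex ey; rewrite -[LHS]/(m (tot X x) (tot X y)) ex ey.
Qed.

Lemma ps_tensor p q : tensor_of (@ps_mul R P A X p q).
Proof.
have [T [t [M [tt uM Mt]]]] := ps_mul_unitary X p q.
have -> : @ps_mul R P A X p q = fun x y => M (t x y).
  by apply/funext => x; apply/funext => y; rewrite Mt.
exact: tensor_of_unitary.
Qed.

Lemma ps_coef_inj : injective (ps_coef X).
Proof. by have [[M' [_ K _]] _] := ps_coef_iso X; exact: can_inj K. Qed.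

End Total.

Section ZSProduct.
Variables (R : realType) (P : monoidType) (G : groupType).
Variables (Z : zappa_szep P G) (A : ucstar R) (X : product_system P A).
Variable beta : zs_action Z X.

Local Notation coef := (za_coef beta).

Lemma tot_beta g p q (x : X p) (y : X q) : tot X x = tot X y ->
  tot X (za_map beta g x) = tot X (za_map beta g y).
Proof.
pose m (u : {p : P & X p}) := tot X (za_map beta g (projT2 u)).
by move=> e; rewrite -[LHS]/(m (tot X x)) e.
Qed.

Lemma za_coefM g h a : coef g (coef h a) = coef (g * h)%g a.
Proof.
apply: (@ps_coef_inj _ _ _ X); apply: tot_inj.
rewrite -!za_coefE -za_comp; apply: tot_beta.
by rewrite za_coefE.
Qed.

Lemma za_coef1 a : coef 1%g a = a.
Proof.
by apply: (@ps_coef_inj _ _ _ X); apply: tot_inj; rewrite -za_coefE za_id.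
Qed.

Lemma za_coefK g : cancel (coef g) (coef g^-1%g).
Proof. by move=> a; rewrite za_coefM mulVg za_coef1. Qed.

Lemma za_coefVK g : cancel (coef g^-1%g) (coef g).
Proof. by move=> a; rewrite za_coefM mulgV za_coef1. Qed.

Lemma za_actl g p a (x : X p) :
  za_map beta g (a ▷ x) = coef g a ▷ za_map beta g x.
Proof.
apply: tot_inj; rewrite -ps_coef_mull.
rewrite (tot_beta g (esym (ps_coef_mull a x))) za_mul.
by apply: tot_mul; rewrite ?za_coefE // zs_rese.
Qed.

Lemma za_actr g p a (x : X p) :
  za_map beta g (x ◁ a) = za_map beta g x ◁ coef (zs_res Z p g) a.
Proof.
apply: tot_inj; rewrite -ps_coef_mulr.
rewrite (tot_beta g (esym (ps_coef_mulr a x))) za_mul.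
by apply: tot_mul; rewrite ?za_coefE.
Qed.

Lemma za_surj g p (w : X (zs_act Z g p)) : exists x : X p, za_map beta g x = w.
Proof.
have e : zs_act Z g^-1%g (zs_act Z g p) = p.
  by rewrite -zs_actM mulVg zs_act1.
have [x hx] := tot_cast e (za_map beta g^-1%g w); exists x; apply: tot_inj.
by rewrite (tot_beta g hx) za_comp mulgV za_id.
Qed.

(* The fibre over (p, g): x in X_p stands for the element x (x) g. The module
   keeps the norm of X_p because *-automorphisms are isometric. *)
Definition zsp_hilbert (a : bowtie Z) : hilbert A.
Proof.
refine (@Hilbert R A (X a.1) (fun x c => x ◁ coef a.2 c)
  (fun x y => coef a.2^-1%g ⟨x, y⟩) _ _ _ _ _ _ _ _).
- by move=> c; exact: hb_actl.
- move=> x k c d /=; have [[cl _ _] _] := za_auto beta a.2.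
  by rewrite cl hb_actr.
- move=> x c d; have [[_ cM _] _] := za_auto beta a.2.
  by rewrite cM hb_actM.
- move=> x k y z; have [[cl _ _] _] := za_auto beta a.2^-1%g.
  by rewrite hb_innerr cl.
- move=> x y c; have [[_ cM _] _] := za_auto beta a.2^-1%g.
  by rewrite hb_innerA cM za_coefK.
- move=> x y; have [[_ _ cS] _] := za_auto beta a.2^-1%g.
  by rewrite hb_innerC cS.
- move=> x; have [[_ cM cS] _] := za_auto beta a.2^-1%g.
  by have [b ->] := hb_pos x; exists (coef a.2^-1%g b); rewrite cM cS.
- by move=> x; rewrite (star_auto_isometry (za_auto beta _)) hb_norm.
Defined.

Definition zsp_fib (a : bowtie Z) : corr A.
Proof.
refine (@Corr R A (zsp_hilbert a) (fun c (x : X a.1) => c ▷ x) _ _ _).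
- by move=> c x y /=; rewrite co_adj.
- by move=> x; exact: co_actl.
- by move=> *; rewrite co_actM.
Defined.

Definition zsp_mul (a b : bowtie Z) (x : zsp_fib a) (y : zsp_fib b) :
    zsp_fib (a * b)%g :=
  ps_mul (x : X a.1) (za_map beta a.2 (y : X b.1)).

Lemma zsp_tot (a b : bowtie Z) (x : zsp_fib a) (y : zsp_fib b) :
  tot X (x : X a.1) = tot X (y : X b.1) -> a.2 = b.2 ->
  tot zsp_fib x = tot zsp_fib y.
Proof.
pose m (u : {p : P & X p}) (g : G) :=
  tot zsp_fib (projT2 u : zsp_fib (projT1 u, g)).
case: a b x y => [p g] [q h] x y /= e <-.
by rewrite -[LHS]/(m (tot X (x : X p)) g) e.
Qed.

Lemma zsp_mulA (a b c : bowtie Z) (x : zsp_fib a) (y : zsp_fib b)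
    (z : zsp_fib c) :
  tot zsp_fib (zsp_mul x (zsp_mul y z)) = tot zsp_fib (zsp_mul (zsp_mul x y) z).
Proof.
apply: zsp_tot; last by rewrite mulgA.
rewrite /zsp_mul /= -ps_mulA; apply: tot_mul => //.
rewrite za_mul; apply: tot_mul => //.
exact: za_comp.
Qed.

Lemma zsp_coef_iso : corr_iso (ps_coef X : regular A -> zsp_fib 1%g).
Proof.
have [[M' [adj MK M'K]] Ml] := ps_coef_iso X; split=> [|a x].
  exists M'; split=> // x y; rewrite -[LHS]/(coef 1^-1%g ⟨ps_coef X x, y⟩).
  by rewrite invg1 za_coef1; exact: adj.
exact: Ml.
Qed.

Lemma zsp_tensor (a b : bowtie Z) : tensor_of (@zsp_mul a b).
Proof.
have [tl tr tb ta ti td] := ps_tensor X a.1 (zs_act Z a.2 b.1).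
split.
- by move=> y k u v; exact: tl.
- by move=> x k u v; rewrite /zsp_mul za_lin; exact: tr.
- move=> x c y; rewrite /zsp_mul [RHS]/= za_actl; exact: tb.
- move=> x y c; rewrite /zsp_mul.
  rewrite -[y ◁ c]/((y : X b.1) ◁ coef b.2 c) za_actr ta za_coefM.
  by [].
- move=> x y x' y'; rewrite /zsp_mul.
  rewrite -[LHS]/(coef (zs_res Z b.1 a.2 * b.2)^-1%g
     ⟨ps_mul (x : X a.1) (za_map beta a.2 (y : X b.1)),
      ps_mul (x' : X a.1) (za_map beta a.2 (y' : X b.1))⟩).
  rewrite ti -[⟨x : X a.1, _⟩](za_coefVK a.2) -za_actl za_inner za_coefM.
  by rewrite invgM -mulgA mulVg mulg1.
- move=> O O0 oO; have [w [Ow [n [x [y wE]]]]] := td O O0 oO.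
  exists w; split=> //.
  pose y' i := projT1 (cid (za_surj (y i))).
  exists n, x, y'; rewrite wE; apply: eq_bigr => i _.
  by rewrite /zsp_mul /y'; case: (cid _) => /= v ->.
Qed.

Definition zs_product : product_system (bowtie Z) A.
Proof.
refine (@ProductSystem R (bowtie Z) A zsp_fib zsp_mul zsp_mulA
  (ps_coef X : A -> zsp_fib 1%g) zsp_coef_iso _ _ _).
- move=> a b; exists (zsp_fib (a * b)%g), (@zsp_mul a b), id; split=> //.
    exact: zsp_tensor.
  by exists id; split.
- move=> a c x; apply: zsp_tot; last by rewrite /= zs_res1 mul1g.
  rewrite /zsp_mul /= -ps_coef_mull; apply: tot_mul => //; exact: za_id.
- move=> a c x; apply: zsp_tot; last by rewrite /= zs_rese mulg1.
  rewrite /zsp_mul /= -ps_coef_mulr; apply: tot_mul => //; exact: za_coefE.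
Defined.

End ZSProduct.

(* Main.v *)
(** The fibre of [X ⋈ G] over [(p, g)] is [X p] with its inner product twisted
    by an automorphism of [A], so both have the same rank-one operators and the
    same compact operators, and the right ideal of [(p, g)] is [pP × G]. Hence a
    family [Phi] on [X ⋈ G] with [Phi (p, g) x = psi p x U_g] and [U_g] unitary
    is Nica-covariant exactly when [psi] is. A covariant pair [(psi, U)] gives
    such a [Phi]; conversely [Phi] determines [psi p = Phi (p, e)] and
    [U_g = Phi (e, g) 1], where the unit of [NT_(X ⋈ G)] is the image of the
    unit of [A]. The two resulting homomorphisms between the universal algebras
    are inverse to each other on generators, hence everywhere, since
    *-homomorphisms are contractive. *)
Require Import Defs.
From HB Require Import structures.
From mathcomp Require Import all_boot all_order all_algebra.
From mathcomp Require Import complex.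
From mathcomp Require Import all_classical all_reals all_analysis.

Set Implicit Arguments.
Unset Strict Implicit.
Unset Printing Implicit Defensive.
Import Order.TTheory GRing.Theory Num.Theory.
Import numFieldNormedType.Exports.
Local Open Scope classical_set_scope.
Local Open Scope ring_scope.
Local Open Scope cstar_scope.

(** * Consequences of linearity *)

Section LinearMaps.
Variables (K : pzRingType) (E F : lmodType K) (f : E -> F).
Hypothesis fl : linear f.

Lemma lin_add u v : f (u + v) = f u + f v.
Proof. by have := fl 1 u v; rewrite !scale1r. Qed.

Lemma lin_zero : f 0 = 0.
Proof. by apply: (addrI (f 0)); rewrite -lin_add !addr0. Qed.

Lemma lin_scale (k : K) u : f (k *: u) = k *: f u.
Proof. by have := fl k u 0; rewrite lin_zero !addr0. Qed.

Lemma lin_sub u v : f (u - v) = f u - f v.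
Proof. by rewrite -scaleN1r lin_add lin_scale scaleN1r. Qed.

End LinearMaps.

(** * Contractivity of star-homomorphisms and arguments on generators *)

Section StarHoms.
Variable R : realType.

Lemma cs_star_one (A : ucstar R) : cs_star (uc_one A) = uc_one A.
Proof.
rewrite -[LHS]uc_mul1l -{1}[uc_one A]cs_starK -cs_starM uc_mul1l.
exact: cs_starK.
Qed.

(** The C*-identity gives [|p| = |p|^2], so the norm is 0 or 1. *)
Lemma projection_norm (B : cstar R) (p : B) :
  cs_star p = p -> p ⋆ p = p -> `|p| <= 1.
Proof.
move=> sp pp; have := cs_normC p; rewrite sp pp expr2.
have [->|n0] := eqVneq `|p| 0; first by rewrite ler01.
by move=> /esym /(canRL (mulfK n0)); rewrite mulfV // => ->.
Qed.

(* If [a] is self-adjoint with [`|a| < 1] and [b] is a self-adjoint square root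
   of [1 - a^2] commuting with [a], then [f a + i f b] is a partial isometry
   whose real part is [f a]. *)
Lemma star_hom_contract (A : ucstar R) (B : cstar R) (f : A -> B) :
  star_hom f -> forall a, `|f a| <= `|a|.
Proof.
move=> [fl fM fS].
have small a : cs_star a = a -> `|a| < 1 -> `|f a| <= 1.
  move=> sa a1; have [c [sc ac cc]] := sqrt_fixpoint sa a1.
  (* Since [2c = a^2 + c^2], this [b] satisfies [b^2 = 1 - a^2]. *)
  pose b := uc_one A - c.
  have sb : cs_star b = b by rewrite cs_starD cs_starN cs_star_one sc.
  have ab : a ⋆ b = b ⋆ a.
    by rewrite cs_mulDl cs_mulDr cs_mulNl cs_mulNr uc_mul1l uc_mul1r ac.
  have bb : a ⋆ a + b ⋆ b = uc_one A.
    have -> : b ⋆ b = uc_one A - (c + c) + c ⋆ c.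
      rewrite cs_mulDl !cs_mulDr !cs_mulNl !cs_mulNr !uc_mul1l uc_mul1r opprK.
      by rewrite opprD !addrA.
    by rewrite cc opprD [uc_one A + (_ + _)]addrA subrK addrCA subrr addr0.
  pose u := f a + 'i *: f b.
  have su : cs_star u = f a - 'i *: f b.
    by rewrite cs_starD cs_starZ -!fS sa sb conjCi scaleNr.
  (* [f] need not preserve units, but [f 1] is a projection, which is enough to bound [u]. *)
  have uu : cs_star u ⋆ u = f (uc_one A).
    rewrite su cs_mulDl !cs_mulDr !cs_mulNl !cs_mulZl !cs_mulZr.
    rewrite -!fM -ab scalerA -expr2 sqrCi scaleN1r opprK.
    by rewrite addrA addrK -(lin_add fl) bb.
  have u1 : `|u| <= 1.
    have : `|u| ^+ 2 <= 1.
      rewrite -cs_normC uu; apply: projection_norm.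
        by rewrite -fS cs_star_one.
      by rewrite -fM uc_mul1l.
    by rewrite expr_le1.
  have -> : f a = 2^-1 *: (u + cs_star u).
    rewrite su addrACA subrr addr0.
    have -> : f a + f a = (2 : R[i]) *: f a by rewrite scaler_nat mulr2n.
    by rewrite scalerA mulVf ?scale1r // pnatr_eq0.
  rewrite normrZ ger0_norm ?invr_ge0 // mulrC ler_pdivrMr // mul1r.
  apply: (le_trans (ler_normD _ _)); rewrite cs_norm_star.
  by rewrite -[2]/(1 + 1) lerD.
have sa_contract a : cs_star a = a -> `|f a| <= `|a|.
  move=> sa; rewrite real_leNgt ?normr_real //; apply/negP => lt.
  (* For the midpoint [m] of [|a|] and [|f a|], the element [a / m] has norm below 1 while its image
     has norm above 1. *)
  have [e1 e2] := midf_lt lt.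
  set m := (_ + _) / 2 in e1 e2.
  have m0 : 0 < m := le_lt_trans (normr_ge0 a) e1.
  have := small (m^-1 *: a).
  rewrite cs_starZ sa (lin_scale fl) !normrZ.
  have mr : m^-1^* = m^-1 by apply/CrealP; rewrite realV gtr0_real.
  rewrite mr normfV gtr0_norm // ![m^-1 * _]mulrC ltr_pdivrMr // mul1r.
  rewrite ler_pdivrMr // mul1r => /(_ erefl e1) h.
  by have := le_lt_trans h e2; rewrite ltxx.
move=> a; have : `|f a| ^+ 2 <= `|a| ^+ 2.
  rewrite -!cs_normC -fS -fM; apply: sa_contract.
  by rewrite cs_starM cs_starK.
by rewrite ler_pXn2r // nnegrE.
Qed.

Lemma star_hom_comp (A B C : cstar R) (g : B -> C) (f : A -> B) :
  star_hom g -> star_hom f -> star_hom (g \o f).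
Proof.
move=> [gl gM gS] [fl fM fS]; split=> [k u v|u v|u] /=.
- by rewrite fl gl.
- by rewrite fM gM.
- by rewrite fS gS.
Qed.

Lemma star_hom_id (A : cstar R) : star_hom (@id A).
Proof. by split. Qed.

(** A point [u] of the closure lies within [e / K] of some [v] with [d v = 0], whence
    [|d u| <= e]. *)
Lemma closed_kernel (E F : normedModType R[i]) (d : E -> F) (K : R[i]) :
  linear d -> 0 < K -> (forall u, `|d u| <= K * `|u|) ->
  closed [set u | d u = 0].
Proof.
move=> dl K0 dK u cu; apply/eqP; rewrite -normr_le0.
apply/ler_addgt0Pr => e e0; rewrite add0r.
have [v [/= dv uv]] := cu _ (nbhsx_ballx u (e / K) (divr_gt0 e0 K0)).
rewrite -[d u]subr0 -dv -(lin_sub dl); apply: (le_trans (dK _)).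
rewrite mulrC -ler_pdivlMr //.
by move: uv; rewrite -ball_normE => /ltW.
Qed.

(** The elements where [f] and [g] agree form a C*-subalgebra; it is closed because contractivity
    bounds [f - g] by 2. *)
Lemma star_hom_ext (A : ucstar R) (B : cstar R) (f g : A -> B) (S : set A) :
  star_hom f -> star_hom g -> generated_by S -> (forall a, S a -> f a = g a) ->
  f =1 g.
Proof.
move=> hf hg gS fg a; have [fl fM fS] := hf; have [gl gM gS'] := hg.
suff /(_ a) : forall a, [set a | f a = g a] a by [].
move=> {}a; rewrite (gS [set a | f a = g a]) //; split=> /=.
- by rewrite !lin_zero.
- by move=> k u v /= fu fv; rewrite fl gl fu fv.
- by move=> u v /= fu fv; rewrite fM gM fu fv.
- by move=> u /= fu; rewrite fS gS' fu.
have -> : [set u | f u = g u] = [set u | f u - g u = 0].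
  apply/seteqP; split=> u /=; first by move=> ->; rewrite subrr.
  by move/eqP; rewrite subr_eq0 => /eqP.
apply: (@closed_kernel _ _ (fun u => f u - g u) 2) => // [k u v|u].
  by rewrite fl gl opprD addrACA scalerBr.
apply: (le_trans (ler_normB _ _)); rewrite mulr_natl mulr2n.
by rewrite lerD // star_hom_contract.
Qed.

(** As [e] is self-adjoint, the adjoint exchanges the two conditions, so the elements satisfying
    both form a C*-subalgebra. This provides the unit of the universal algebra of the product system
    over [P ⋈ G]. *)
Lemma generated_unit (A : cstar R) (e : A) (S : set A) :
  cs_star e = e -> generated_by S ->
  (forall a, S a -> e ⋆ a = a /\ a ⋆ e = a) ->
  left_id e (@cs_mul R A) /\ right_id e (@cs_mul R A).
Proof.
move=> se gS he.
suff main a : [set a | e ⋆ a = a /\ a ⋆ e = a] a.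
  by split=> a; have [] := main a.
rewrite (gS [set a | e ⋆ a = a /\ a ⋆ e = a]) //; split=> /=.
- by rewrite cs_mul0l cs_mul0r.
- move=> k u v [eu ue] [ev ve].
  by rewrite cs_mulDr cs_mulDl cs_mulZl cs_mulZr eu ue ev ve.
- by move=> u v [eu ue] [ev ve]; rewrite cs_mulA eu -cs_mulA ve.
- by move=> u [eu ue]; split; rewrite -[e in LHS]se -cs_starM ?ue ?eu.
have -> : [set u | e ⋆ u = u /\ u ⋆ e = u] =
    [set u | e ⋆ u - u = 0] `&` [set u | u ⋆ e - u = 0].
  apply/seteqP; split=> u /= [eu ue]; first by rewrite eu ue subrr.
  by split; apply/eqP; rewrite -subr_eq0 ?eu ?ue.
(* This constant bounds [u |-> e u - u] and stays positive when [e = 0]. *)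
have K0 : 0 < `|e| + 1 by rewrite ltr_wpDl.
apply: closedI.
- apply: (closed_kernel _ K0) => [k u v|u].
    by rewrite cs_linr opprD addrACA scalerBr.
  apply: (le_trans (ler_normB _ _)).
  by rewrite mulrDl mul1r lerD // cs_normM.
- apply: (closed_kernel _ K0) => [k u v|u].
    by have /= -> := cs_linl e k u v; rewrite opprD addrACA scalerBr.
  apply: (le_trans (ler_normB _ _)).
  by rewrite mulrDl mul1r lerD // mulrC cs_normM.
Qed.

End StarHoms.

(** * The unit of the coefficient algebra acting on the fibres *)

Section ProductSystems.
Variables (R : realType) (P : monoidType) (A : ucstar R).
Variable X : product_system P A.

(** Avoids casts between fibres whose indices, such as [1 * p] and [p], are equal but not
    convertible. *)
Lemma tot_eval (B : Type) (f : forall p, X p -> B) p q (x : X p) (y : X q) :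
  tot X x = tot X y -> f p x = f q y.
Proof.
pose m (u : {p : P & X p}) := f (projT1 u) (projT2 u).
by move=> e; rewrite -[LHS]/(m (tot X x)) e.
Qed.

Lemma ps_coef_innerE a b : ⟨ps_coef X a, ps_coef X b⟩ = cs_star a ⋆ b.
Proof.
by have [uM _] := ps_coef_iso X; rewrite (unitary_inner uM).
Qed.

Lemma hb_act1 p (x : X p) : x ◁ uc_one A = x.
Proof. by apply: hb_inner_inj => z; rewrite hb_innerA uc_mul1r. Qed.

(* With [e] the projection [x |-> 1 ▷ x], the operator [2 e - 1] is a
   self-adjoint involution, hence isometric. *)
Lemma co_act1_contract p (x : X p) : `|uc_one A ▷ x| <= `|x|.
Proof.
set e := @co_act R A (X p) (uc_one A).
have eA y z : ⟨e y, z⟩ = ⟨y, e z⟩ by rewrite /e co_adj cs_star_one.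
have el : linear e.
  move=> k y z; apply: hb_inner_inj => w.
  by rewrite -eA !hb_innerr !eA.
have ee y : e (e y) = e y by rewrite /e -co_actM uc_mul1l.
pose u y := e y + e y - y.
have uA y z : ⟨u y, z⟩ = ⟨y, u z⟩.
  rewrite hb_innerC (lin_sub (hb_innerr _)) (lin_add (hb_innerr _)).
  rewrite cs_starD cs_starN cs_starD -!hb_innerC eA.
  by rewrite (lin_sub (hb_innerr _)) (lin_add (hb_innerr _)).
have uu y : u (u y) = y.
  rewrite /u (lin_sub el) (lin_add el) ee addrK opprB.
  by rewrite addrC subrK.
have un : `|u x| = `|x|.
  apply/eqP; rewrite -(eqrXn2 (isT : 0 < 2)%N) ?normr_ge0 //.
  by rewrite !hb_norm uA uu.
have -> : e x = 2^-1 *: (u x + x).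
  rewrite subrK; have -> : e x + e x = (2 : R[i]) *: e x.
    by rewrite scaler_nat mulr2n.
  by rewrite scalerA mulVf ?scale1r // pnatr_eq0.
rewrite normrZ ger0_norm ?invr_ge0 // mulrC ler_pdivrMr //.
by apply: (le_trans (ler_normD _ _)); rewrite un mulr_natr mulr2n.
Qed.

(* The unit fixes the products [ps_coef a * y], which span a dense subspace. *)
Lemma co_act1 p (x : X p) : uc_one A ▷ x = x.
Proof.
(* With the index in the form [1 * p], the density of products from [ps_tensor] applies. *)
move: x; rewrite -(mul1g p) => x.
set e := @co_act R A (X (1 * p)%g) (uc_one A).
have el : linear e.
  move=> k y z; apply: hb_inner_inj => w.
  by rewrite /e hb_innerr -[uc_one A]cs_star_one -!co_adj hb_innerr.
have ecl : closed [set y | y - e y = 0].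
  apply: (@closed_kernel _ _ _ (fun y => y - e y) 2) => // [k y z|y].
    by rewrite el opprD addrACA scalerBr.
  apply: (le_trans (ler_normB _ _)); rewrite mulr_natl mulr2n.
  by rewrite lerD // co_act1_contract.
suff /(_ x) : forall x, [set y | y - e y = 0] x.
  by move=> /= /eqP; rewrite subr_eq0 => /eqP.
move=> y; apply: contrapT => yN.
have [w [wN [n [a [z wE]]]]] := te_dense (ps_tensor X 1%g p)
  (ex_intro _ y yN) (closed_openC ecl).
apply: wN; rewrite /= wE (big_morph e (lin_add el) (lin_zero el)).
rewrite -sumrB big1 // => i _; apply/eqP; rewrite subr_eq0 eq_sym; apply/eqP.
have [uM cM] := ps_coef_iso X.
have [b <-] := unitary_surj uM (a i).
apply: tot_inj; rewrite -ps_coef_mull ps_mulA; apply: tot_mul => //.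
by rewrite ps_coef_mull -cM /= uc_mul1l.
Qed.

Lemma ps_mul1l p (x : X p) :
  tot X (ps_mul (ps_coef X (uc_one A)) x) = tot X x.
Proof. by rewrite ps_coef_mull co_act1. Qed.

Lemma ps_mul1r p (x : X p) :
  tot X (ps_mul x (ps_coef X (uc_one A))) = tot X x.
Proof. by rewrite ps_coef_mulr hb_act1. Qed.

End ProductSystems.

(** * Ideals and compact operators of the Zappa-Szép product *)

Section Bowtie.
Variables (R : realType) (P : monoidType) (G : groupType).
Variables (Z : zappa_szep P G) (A : ucstar R) (X : product_system P A).
Variable beta : zs_action Z X.

Local Notation Y := (zs_product beta).

(** [G] acts on [P] by bijections and its elements are invertible, so [a * c = b] is solvable for
    [c] as soon as its first coordinate is. *)
Lemma rideal_bowtie (a : bowtie Z) : rideal a = [set b | rideal a.1 b.1].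
Proof.
apply/seteqP; split=> [_ [c _ <-]|b [q _ qb]] /=.
  by exists (zs_act Z a.2 c.1).
pose q' := zs_act Z a.2^-1%g q.
exists (q', (zs_res Z q' a.2)^-1 * b.2)%g => //.
rewrite -[LHS]/((a.1 * zs_act Z a.2 q')%g,
  (zs_res Z q' a.2 * ((zs_res Z q' a.2)^-1 * b.2))%g).
by rewrite mulVKg -zs_actM mulgV zs_act1 qb -surjective_pairing.
Qed.

Lemma rideal_bowtieI (a b c : bowtie Z) :
  rideal a `&` rideal b = rideal c <->
  rideal a.1 `&` rideal b.1 = rideal c.1.
Proof.
rewrite !rideal_bowtie; split=> [/seteqP[h1 h2]|/seteqP[h1 h2]].
  apply/seteqP; split=> p hp; first exact: (h1 (p, 1%g)).
  exact: (h2 (p, 1%g)).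
by apply/seteqP; split=> p hp; [exact: h1|exact: h2].
Qed.

Lemma rideal_bowtie0 (a b : bowtie Z) :
  rideal a `&` rideal b = set0 <-> rideal a.1 `&` rideal b.1 = set0.
Proof.
rewrite !rideal_bowtie -!subset0; split=> h p hp; last exact: (h p.1).
exact: (h (p, 1%g)).
Qed.

(** The right action is twisted by an automorphism and the inner product by its inverse, so the
    twists cancel. *)
Lemma theta_bowtie (a : bowtie Z) (x y : Y a) :
  theta x y = theta (x : X a.1) (y : X a.1).
Proof. by apply/funext => z; rewrite /theta /= za_coefVK. Qed.

Lemma is_adjoint_bowtie (a : bowtie Z) (S S' : X a.1 -> X a.1) :
  is_adjoint (S : Y a -> Y a) (S' : Y a -> Y a) <-> is_adjoint S S'.
Proof.
split=> h x y; last by rewrite /= h.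
exact: (can_inj (za_coefVK beta a.2) (h x y)).
Qed.

Lemma adjointable_bowtie (a : bowtie Z) (S : X a.1 -> X a.1) :
  adjointable (S : Y a -> Y a) <-> adjointable S.
Proof. by split=> -[S' h]; exists S'; apply/is_adjoint_bowtie. Qed.

(** Both fibres share carrier, linear structure and norm; only the clauses mentioning adjoints need
    translation. *)
Lemma op_subalgebra_bowtie (a : bowtie Z) (D : set (X a.1 -> X a.1)) :
  op_subalgebra (D : set (Y a -> Y a)) <-> op_subalgebra D.
Proof.
split=> -[dA d0 dL dC dS dcl]; split=> //.
- by move=> S /dA /adjointable_bowtie.
- by move=> S S' DS /is_adjoint_bowtie; exact: dS.
- by move=> S /adjointable_bowtie; exact: dcl.
- by move=> S /dA /adjointable_bowtie.
- by move=> S S' DS /is_adjoint_bowtie; exact: dS.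
- by move=> S /adjointable_bowtie; exact: dcl.
Qed.

Lemma compact_op_bowtie (a : bowtie Z) (S : X a.1 -> X a.1) :
  compact_op (S : Y a -> Y a) <-> compact_op S.
Proof.
split=> h D hD Dth; apply: h; try exact/op_subalgebra_bowtie.
- by move=> x y; rewrite theta_bowtie.
- by move=> x y; have := Dth x y; rewrite theta_bowtie.
Qed.

Lemma amplifies_bowtie (a c : bowtie Z) (S : X a.1 -> X a.1)
    (S' : X c.1 -> X c.1) :
  @amplifies _ _ _ Y a c S S' <-> amplifies S S'.
Proof.
split=> -[aS' h]; split; try exact/adjointable_bowtie.
- move=> q x y z w zE wE.
  (* The factor [y] is pulled back along the action of [a.2], so that [x y] becomes the product of
     [x] and [y'] in [Y]. *)
  pose q' := zs_act Z a.2^-1%g q; pose y' := za_map beta a.2^-1%g y.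
  have yE : tot X (za_map beta a.2 y') = tot X y by rewrite za_comp mulgV za_id.
  (* The second coordinate is chosen so that [a * b] has group coordinate [c.2]. *)
  pose b : bowtie Z := (q', (zs_res Z q' a.2)^-1 * c.2)%g.
  have cE : c.2 = (zs_res Z q' a.2 * b.2)%g by rewrite /= mulVKg.
  apply: (h b x y'); apply: zsp_tot => //.
  + by rewrite zE; apply: tot_mul.
  + by rewrite wE; apply: tot_mul.
- move=> b x y z w zE wE.
  have tX (d d' : bowtie Z) (u : Y d) (v : Y d') :
      tot Y u = tot Y v -> tot X (u : X d.1) = tot X (v : X d'.1).
    exact: (tot_eval (fun (d : bowtie Z) (u : Y d) => tot X (u : X d.1))).
  exact: (h _ x _ z w (tX _ _ _ _ zE) (tX _ _ _ _ wE)).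
Qed.

Lemma is_join_bowtie (a b c : bowtie Z) (S : X a.1 -> X a.1)
    (T : X b.1 -> X b.1) (V : X c.1 -> X c.1) :
  @is_join _ _ _ Y a b c S T V <-> is_join S T V.
Proof.
by split=> -[S' [T' [/amplifies_bowtie aS /amplifies_bowtie aT VE]]];
  exists S', T'; split.
Qed.

(** * Transfer of Nica covariance *)

Section Nica.
Variables (B : cstar R) (phi : forall a : bowtie Z, Y a -> B)
  (psi : forall p, X p -> B).

Lemma induced_bowtie (a : bowtie Z) (f : (X a.1 -> X a.1) -> B) :
  (forall x y : X a.1,
     phi (x : Y a) ⋆ cs_star (phi (y : Y a)) = psi x ⋆ cs_star (psi y)) ->
  Defs.induced (X := Y) (p := a) (@phi a) f <-> Defs.induced (@psi a.1) f.
Proof.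
move=> phipsi; split=> -[fl fM fS fth]; split.
- by move=> k S T /compact_op_bowtie hS /compact_op_bowtie hT; apply: fl.
- by move=> S T /compact_op_bowtie hS /compact_op_bowtie hT; apply: fM.
- by move=> S S' /compact_op_bowtie hS /is_adjoint_bowtie; apply: fS.
- by move=> x y; rewrite -theta_bowtie fth.
- by move=> k S T /compact_op_bowtie hS /compact_op_bowtie hT; apply: fl.
- by move=> S T /compact_op_bowtie hS /compact_op_bowtie hT; apply: fM.
- by move=> S S' /compact_op_bowtie hS /is_adjoint_bowtie; apply: fS.
- by move=> x y; rewrite theta_bowtie fth phipsi.
Qed.

(** The induced maps depend on [phi] and [psi] only through the values on rank-one operators, which
    agree by hypothesis. *)
Lemma nica_covariant_bowtie :
  (forall (a : bowtie Z) (x y : X a.1),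
     phi (x : Y a) ⋆ cs_star (phi (y : Y a)) = psi x ⋆ cs_star (psi y)) ->
  nica_covariant phi <-> nica_covariant psi.
Proof.
move=> phipsi; split=> -[f fI hf].
  exists (fun p => f (p, 1%g)) => [p|p q S T cS cT].
    by apply/(induced_bowtie (a := (p, 1%g))) => //; exact: phipsi.
  have [] := hf (p, 1%g) (q, 1%g) S T.
  - exact/compact_op_bowtie.
  - exact/compact_op_bowtie.
  - move=> h1 h2; split=> [r V rE V_|rE].
      by apply: (h1 (r, 1%g)); [exact/rideal_bowtieI|exact/is_join_bowtie].
    by apply: h2; exact/rideal_bowtie0.
(* One induced map serves all fibres over [(p, g)] with the same [p]. *)
exists (fun a => f a.1) => [a|a b S T cS cT].
  by apply/induced_bowtie => //; exact: phipsi.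
have [] := hf a.1 b.1 S T.
- exact/compact_op_bowtie.
- exact/compact_op_bowtie.
- move=> h1 h2; split=> [c V /rideal_bowtieI cE /is_join_bowtie V_|].
    exact: h1.
  by move=> /rideal_bowtie0; exact: h2.
Qed.

End Nica.

(** * Covariant pairs versus representations of [Y] *)

Section Covariant.
Variable B : ucstar R.

Lemma unitary_rep1 (U : G -> B) : unitary_rep U -> U 1%g = uc_one B.
Proof.
move=> [UM UsU _]; rewrite -[LHS]uc_mul1l -(UsU 1%g) -cs_mulA -UM.
by rewrite mulg1.
Qed.

Lemma unitary_repV (U : G -> B) : unitary_rep U ->
  forall g, cs_star (U g) = U g^-1%g.
Proof.
move=> hU g; have [UM UsU _] := hU.
by rewrite -[LHS]uc_mul1r -(unitary_rep1 hU) -(mulgV g) UM cs_mulA UsU uc_mul1l.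
Qed.

(** This is covariance at [p = 1], where [g|_1 = g]. *)
Lemma covariant_rep_coef (psi : forall p, X p -> B) (U : G -> B) :
  covariant_rep beta psi U -> forall g a,
  U g ⋆ psi 1%g (ps_coef X a) = psi 1%g (ps_coef X (za_coef beta g a)) ⋆ U g.
Proof.
move=> [_ _ _ cov] g a; rewrite cov zs_rese; congr (_ ⋆ _).
exact: (tot_eval psi (za_coefE beta g a)).
Qed.

Lemma covariant_rep_bowtie (psi : forall p, X p -> B) (U : G -> B) :
  covariant_rep beta psi U ->
  representation (X := Y) (fun a (x : X a.1) => psi a.1 x ⋆ U a.2).
Proof.
move=> cr; have [[psil psic psiM psii] psi1 hU cov] := cr.
have U1 := unitary_rep1 hU; have [UM UsU _] := hU.
split.
- by move=> a k x y /=; rewrite psil cs_mulDl cs_mulZl.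
- have -> : (fun a => psi 1%g (ps_coef X a) ⋆ U 1%g) =
      (fun a => psi 1%g (ps_coef X a)).
    by apply/funext => a; rewrite U1 uc_mul1r.
  exact: psic.
- move=> a b x y /=.
  by rewrite -cs_mulA (cs_mulA (U a.2)) cov -cs_mulA -UM cs_mulA psiM.
- move=> a x y /=.
  (* Conjugating by [U_g^*] applies the automorphism of [g^-1] to [⟨x, y⟩], which is the twisted
     inner product. *)
  rewrite cs_starM -cs_mulA (cs_mulA (cs_star (psi _ x))) psii.
  rewrite unitary_repV // cs_mulA (covariant_rep_coef cr) -cs_mulA -UM.
  by rewrite mulVg.
Qed.

(** Apply [Psi] to the factorization [x ⊗ g = (x ⊗ 1)(1 ⊗ g)]. *)
Lemma representation_bowtie_act (Psi : forall a : bowtie Z, Y a -> B) :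
  representation (X := Y) Psi -> forall (a : bowtie Z) (x : X a.1),
  Psi a x = Psi (a.1, 1%g) x ⋆ Psi (1%g, a.2) (ps_coef X (uc_one A)).
Proof.
move=> [_ _ PsiM _] a x; rewrite PsiM.
apply: (tot_eval Psi); apply: zsp_tot; last by rewrite /= zs_res1 mul1g.
rewrite -[LHS]ps_mul1r; apply: tot_mul => //=.
by rewrite za_id.
Qed.

Lemma za_coef_one g : za_coef beta g (uc_one A) = uc_one A.
Proof.
have [[_ cM _] _] := za_auto beta g.
rewrite -[LHS]uc_mul1r -{2}(za_coefVK beta g (uc_one A)) -cM uc_mul1l.
exact: za_coefVK.
Qed.

Lemma bowtie_covariant_rep (Psi : forall a : bowtie Z, Y a -> B) :
  representation (X := Y) Psi -> Psi 1%g (ps_coef X (uc_one A)) = uc_one B ->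
  covariant_rep beta (fun p (x : X p) => Psi (p, 1%g) x)
    (fun g => Psi (1%g, g) (ps_coef X (uc_one A))).
Proof.
move=> hPsi Psi1; have [Psil Psic PsiM Psii] := hPsi.
pose V g := Psi (1%g, g) (ps_coef X (uc_one A)).
have VM g h : V (g * h)%g = V g ⋆ V h.
  rewrite PsiM; apply: (tot_eval Psi); apply: zsp_tot => /=.
    rewrite -[LHS]ps_mul1l; apply: tot_mul => //.
    by rewrite za_coefE za_coef_one.
  by rewrite zs_rese.
have V1 : V 1%g = uc_one B by [].
have VsV g : cs_star (V g) ⋆ V g = uc_one B.
  rewrite Psii -[⟨_, _⟩]/(za_coef beta g^-1%g
    ⟨ps_coef X (uc_one A), ps_coef X (uc_one A)⟩).
  by rewrite ps_coef_innerE cs_star_one uc_mul1l za_coef_one.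
(* [V_g] is an isometry with inverse [V_(g^-1)], hence unitary. *)
have Vs g : cs_star (V g) = V g^-1%g.
  by rewrite -[LHS]uc_mul1r -V1 -(mulgV g) VM cs_mulA VsV uc_mul1l.
split=> //.
- split=> // [p|p q x y|p x y].
  + by move=> k x y; exact: (Psil (p, 1%g) k x y).
  + rewrite PsiM; apply: (tot_eval Psi); apply: zsp_tot => /=.
      by apply: tot_mul => //; rewrite za_id.
    by rewrite zs_res1 mulg1.
  + rewrite Psii -[⟨_, _⟩]/(za_coef beta 1^-1%g ⟨x, y⟩).
    by rewrite invg1 za_coef1.
- by split=> // g; rewrite -/(V g) Vs -VM mulgV.
(* Both sides are the image of [β_g(x) ⊗ g|_p], factored in the two possible orders. *)
- move=> p g x; have act := representation_bowtie_act hPsi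
    (a := (zs_act Z g p, zs_res Z p g)) (za_map beta g x).
  apply: etrans act; rewrite PsiM.
  apply: (tot_eval Psi); apply: zsp_tot => /=; last by rewrite mulg1.
  exact: ps_mul1l.
Qed.

End Covariant.

Lemma representation_bowtie_unit (B : cstar R)
    (Psi : forall a : bowtie Z, Y a -> B) :
  representation (X := Y) Psi -> forall (a : bowtie Z) (x : Y a),
  Psi 1%g (ps_coef X (uc_one A)) ⋆ Psi a x = Psi a x /\
  Psi a x ⋆ Psi 1%g (ps_coef X (uc_one A)) = Psi a x.
Proof.
move=> [_ _ PsiM _] a x; rewrite !PsiM.
by split; apply: (tot_eval Psi); [exact: (ps_mul1l (X := Y))|
  exact: (ps_mul1r (X := Y))].
Qed.

End Bowtie.

Theorem corollary4p16 (R : realType) (P : monoidType) (G : groupType)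
    (Z : zappa_szep P G) (A : ucstar R) (X : product_system P A)
    (beta : zs_action Z X)
    (hP : right_lcm P) (hX : compactly_aligned X)
    (N : cstar R) (Psi : forall a, zs_product beta a -> N)
    (hN : is_NT Psi)
    (M : ucstar R) (psi : forall p, X p -> M) (U : G -> M)
    (hM : is_NT_bowtie beta psi U) :
  isomorphic N M.
Proof.
have [Nrep Nnica Ngen Nuniv] := hN; have [Mcov Mnica Mgen Muniv] := hM.
have [_ psi1 hU _] := Mcov.
pose e := Psi 1%g (ps_coef X (uc_one A)).
have se : cs_star e = e.
  by have [_ [_ _ cS] _ _] := Nrep; rewrite -cS cs_star_one.
have [e1l e1r] : left_id e (@cs_mul R N) /\ right_id e (@cs_mul R N).
  apply: (generated_unit se Ngen) => _ [a [x ->]].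
  exact: representation_bowtie_unit.
(* The universal property of [M] concerns unital targets, so [N] is equipped with the unit [e]. *)
pose N1 := UCStar e1l e1r.
pose V g : N1 := Psi (1%g, g) (ps_coef X (uc_one A)).
have Vcov : covariant_rep beta (B := N1) (fun p x => Psi (p, 1%g) x) V.
  exact: bowtie_covariant_rep.
have PsiE a x : Psi a x = Psi (a.1, 1%g) x ⋆ V a.2.
  exact: (representation_bowtie_act (B := N1)).
have VV g : V g ⋆ cs_star (V g) = e.
  by have [_ _ [_ _ VsV] _] := Vcov; exact: VsV.
have Vnica : nica_covariant (B := N1) (fun p x => Psi (p, 1%g) x).
  apply/(nica_covariant_bowtie (phi := Psi)) => // a x y.
  rewrite (PsiE a x) (PsiE a y) cs_starM -cs_mulA (cs_mulA (V _)) VV.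
  by rewrite (uc_mul1l (u := N1)).
pose Phi (a : bowtie Z) (x : X a.1) := psi a.1 x ⋆ U a.2.
have Phirep : representation (X := zs_product beta) Phi.
  exact: covariant_rep_bowtie.
have Phinica : nica_covariant (X := zs_product beta) Phi.
  apply/(nica_covariant_bowtie (psi := psi)) => // a x y.
  have [_ _ UU] := hU.
  by rewrite cs_starM -cs_mulA (cs_mulA (U _)) UU uc_mul1l.
have [h hh hE] := Nuniv _ _ Phirep Phinica.
have [k [hk kE kU]] := Muniv _ _ _ Vcov Vnica.
exists h; split=> //; exists k.
- apply: (star_hom_ext (A := N1) (B := N) (f := k \o h) (g := id) _ _ Ngen).
  + exact: star_hom_comp.
  + exact: star_hom_id.
  + move=> _ [a [x ->]] /=; rewrite hE /Phi.
    by have [_ kM _] := hk; rewrite kM kE kU -PsiE.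
- apply: (star_hom_ext (A := M) (B := M) (f := h \o k) (g := id) _ _ Mgen).
  + exact: star_hom_comp.
  + exact: star_hom_id.
  + move=> _ [[p [x ->]]|[g ->]] /=.
      by rewrite kE hE /Phi /= (unitary_rep1 hU) uc_mul1r.
    (* [V_g] goes to [psi 1 U_g], which is [U_g] because [psi] is unital. *)
    by rewrite kU hE /Phi /= psi1 uc_mul1l.
Qed.
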